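(* Let $\mathcal{P}$ be a model dominated by $\nu$, $P_0\in\mathcal{P}$, and let $\beta:\mathcal{P}\to\mathbb{R}$, $\eta:\mathcal{P}\to\mathcal{H}\subset\mathcal{V}$ be functionals with $\beta_0=\beta(P_0)$, $\eta_0=\eta(P_0)$. Let $m:\mathcal{Z}\times\mathbb{R}\times\mathcal{H}\to\mathbb{R}$ be an estimating function (measurable in $z$ for each $(\beta,\eta)$). Assume: (1) (Correct specification) $\mathbb{E}_P[m(Z;\beta(P),\eta(P))]=0$ for all $P\in\mathcal{P}$ with $(\beta(P),\eta(P))$ in some neighborhood of $(\beta_0,\eta_0)$. (2) (Coordinate smoothness along a dense class) There is a set of scores $S\subset L_\infty(P_0)\cap L_2^0(P_0)$ whose $L_2(P_0)$-closure equals the tangent space $\mathcal{T}$, such that for each $s\in S$ there is a regular submodel $t\mapsto P_{t,s}$ through $P_0$ with score $s$ for which, writing $\beta_{t,s}=\beta(P_{t,s})$ and $\eta_{t,s}=\eta(P_{t,s})$, one has $(\beta_{t,s}-\beta_0)/t\to\dot\beta_{0,s}\in\mathbb{R}$ and $\|(\eta_{t,s}-\eta_0)/t-\dot\eta_{0,s}\|_{\mathcal{V}}\to0$ for some $\dot\eta_{0,s}\in\dot{\mathcal{H}}$, as $t\to0$. (3) (Fréchet differentiability) The map $(\beta,\eta)\mapsto m(\cdot;\beta,\eta)\in L_2(P_0)$ is Fréchet differentiable at $(\beta_0,\eta_0)$: there are bounded linear maps $D_\beta m_0:\mathbb{R}\to L_2(P_0)$ and $D_\eta m_0:\mathcal{V}\to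 L_2(P_0)$ with $$\|m(\cdot;\beta,\eta)-m(\cdot;\beta_0,\eta_0)-D_\beta m_0(\beta-\beta_0)-D_\eta m_0(\eta-\eta_0)\|_{L_2(P_0)}=o(|\beta-\beta_0|+\|\eta-\eta_0\|_{\mathcal{V}}).$$ Write $\partial_\beta m(Z;\beta_0,\eta_0):=D_\beta m_0(1)(Z)$. (4) (Regularity along submodels) For each $s\in S$ and the corresponding submodel from (2), the functions $f_{t,s}(Z):=m(Z;\beta_{t,s},\eta_{t,s})$ are measurable, $f_0:=m(\cdot;\beta_0,\eta_0)$ is bounded, there is $\dot f_0\in L_2(P_0)$ with $\mathbb{E}_0[((f_{t,s}-f_0)/t-\dot f_0)^2]\to0$ as $t\to0$, and there are $\delta>0$, $C<\infty$ with $\sup_{0<|t|<\delta}\mathbb{E}_{P_{t,s}}[((f_{t,s}-f_0)/t)^2]\le C$. (5) (Nondegenerate Jacobian) $G:=\mathbb{E}_0[\partial_\beta m(Z;\beta_0,\eta_0)]\neq0$. (6) (Neyman orthogonality) For all $h\in\dot{\mathcal{H}}$, the Gâteaux derivative satisfies $\frac{\partial}{\partial\eta}\mathbb{E}_0[m(Z;\beta_0,\eta)]\big|_{\eta=\eta_0}[h]=0$. (7) (Hellinger Lipschitz) There are $c,\delta>0$ such that $|\beta(P_1)-\beta(P_2)|\le c\,H(P_1,P_2)$ for all $P_1,P_2\in\mathcal{P}$ with $H(P_i,P_0)\le\delta$, $i=1,2$. Then $\beta$ is pathwise differentiable at $P_0$ with influence function $$\varphi(Z):=-G^{-1}m(Z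;\beta_0,\eta_0).$$
   Context: $(\mathcal{Z},\mathcal{A})$ is a measurable space, $\nu$ a $\sigma$-finite measure on it, and $\mathcal{P}$ (the model) is a set of probability measures all dominated by $\nu$; densities are $p=dP/d\nu$; $P_0\in\mathcal{P}$ is fixed with density $p_0$ and $\mathbb{E}_0=\mathbb{E}_{P_0}$. $L_2^0(P_0)=\{f\in L_2(P_0):\mathbb{E}_0[f]=0\}$. Hellinger distance: $H(P,Q)=\big(\tfrac12\int(\sqrt p-\sqrt q)^2d\nu\big)^{1/2}$. A regular (QMD) submodel through $P_0$ is a family $\{P_t:t\in(-\epsilon,\epsilon)\}\subset\mathcal{P}$ with $P_{t=0}=P_0$ and densities $p_t$ such that for some $s\in L_2^0(P_0)$ (its score), $\int\big(\frac{\sqrt{p_t}-\sqrt{p_0}}{t}-\frac12 s\sqrt{p_0}\big)^2d\nu\to0$ as $t\to0$. $\mathcal{S}$ is the set of scores of all regular submodels through $P_0$, and the tangent space is $\mathcal{T}=\overline{\mathrm{span}(\mathcal{S})}^{L_2(P_0)}$. $\mathcal{V}$ is a normed vector space with norm $\|\cdot\|_{\mathcal{V}}$, $\mathcal{H}\subset\mathcal{V}$, and the set of admissible perturbation directions is $\dot{\mathcal{H}}=\{h\in\mathcal{V}:\exists\epsilon>0,\ \eta_0+th\in\mathcal{H}\ \text{for all}\ |t|<\epsilon\}$. The Gâteaux derivative $\frac{\partial}{\partial\eta}\mathbb{E}_0[m(Z;\beta_0,\eta)]|_{\eta=\eta_0}[h]$ is $\frac{d}{dt}\mathbb{E}_0[m(Z;\beta_0,\eta_0+th)]|_{t=0}$.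 $\beta$ is pathwise differentiable at $P_0$ with influence function $\varphi\in L_2^0(P_0)$ if for every regular submodel $t\mapsto P_{t,s}$ through $P_0$ with score $s$, $\frac{d}{dt}\beta(P_{t,s})|_{t=0}$ exists and equals $\mathbb{E}_0[\varphi(Z)s(Z)]$. *)

(* Defs.v *)
From HB Require Import structures.
From mathcomp Require Import all_boot all_order all_algebra.
From mathcomp Require Import all_classical all_reals all_analysis.

Set Implicit Arguments.
Unset Strict Implicit.
Unset Printing Implicit Defensive.
Import Order.TTheory GRing.Theory Num.Theory.
Import numFieldNormedType.Exports.

Local Open Scope classical_set_scope.
Local Open Scope ring_scope.

(* Elements of L2(P) are represented by measurable functions T -> R with finite
   L2-norm (the library's [Lfun P 2%:E]); identities between them are stated
   P-almost everywhere. The functionals beta and eta on the model and the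
   nuisance argument of m are represented by total functions; their values
   outside the model, resp. outside the nuisance set, are never used.
   A submodel is a total function on R of which only the restriction to the
   interval (-eps, eps) matters. *)

Section model.
Context {d : measure_display} {T : measurableType d} {R : realType}.
Variable nu : {sigma_finite_measure set T -> \bar R}.

Definition density (P : probability T R) : T -> R :=
  fine \o Radon_Nikodym (charge_of_finite_measure P) nu.

Definition hellinger (P Q : probability T R) : R :=
  Num.sqrt (2^-1 *
    \int[nu]_z (Num.sqrt (density P z) - Num.sqrt (density Q z)) ^+ 2).

Definition L2norm (P : probability T R) (f : T -> R) : \bar R :=
  'N[P]_2%:E[EFin \o f]%E.

Definition L20 (P : probability T R) : set (T -> R) :=
  [set f | f \in Lfun P 2%:E /\ 'E_P[f]%E = 0%E].

Definition regular_submodel (model : set (probability T R))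
    (P0 : probability T R) (eps : R) (Pt : R -> probability T R)
    (s : T -> R) : Prop :=
  [/\ 0 < eps,
      forall t : R, `|t| < eps -> model (Pt t),
      Pt 0 = P0,
      L20 P0 s &
      (\int[nu]_z (((Num.sqrt (density (Pt t) z) - Num.sqrt (density P0 z)) / t
         - 2^-1 * s z * Num.sqrt (density P0 z)) ^+ 2)%:E)%E
        @[t --> (0 : R)^'] --> 0%E].

Definition scores (model : set (probability T R)) (P0 : probability T R) :
    set (T -> R) :=
  [set s | exists eps Pt, regular_submodel model P0 eps Pt s].

Definition lin_span (A : set (T -> R)) : set (T -> R) :=
  [set f | exists n (a : 'I_n -> R) (g : 'I_n -> T -> R),
     (forall i, A (g i)) /\ f = fun z => \sum_(i < n) a i * g i z].

Definition L2closure (P : probability T R) (A : set (T -> R)) : set (T -> R) :=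
  [set f | f \in Lfun P 2%:E /\
     forall e : R, 0 < e ->
       exists2 g, A g & (L2norm P (fun z => f z - g z)%R < e%:E)%E].

Definition tangent_space (model : set (probability T R))
    (P0 : probability T R) : set (T -> R) :=
  L2closure P0 (lin_span (scores model P0)).

Definition pathwise_differentiable (model : set (probability T R))
    (P0 : probability T R) (beta : probability T R -> R) (phi : T -> R) : Prop :=
  L20 P0 phi /\
  forall (eps : R) (Pt : R -> probability T R) (s : T -> R),
    regular_submodel model P0 eps Pt s ->
    is_derive (0 : R) (1 : R) (fun t : R => beta (Pt t))
      (fine 'E_P0[(fun z => phi z * s z)%R]%E).

End model.

Definition admissible_directions {R : realType} {V : normedModType R}
    (H : set V) (eta0 : V) : set V :=
  [set h | exists2 eps : R, 0 < eps &
     forall t : R, `|t| < eps -> H (eta0 + t *: h)].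

Definition is_gateaux_derivative {R : realType} {V : normedModType R}
    (F : V -> R) (eta0 h : V) (v : R) : Prop :=
  is_derive (0 : R) (1 : R) (fun t : R => F (eta0 + t *: h)) v.

Section frechet.
Context {d : measure_display} {T : measurableType d} {R : realType}.
Variable P : probability T R.

Definition bounded_linear_L2 {V : normedModType R} (D : V -> T -> R) : Prop :=
  [/\ forall h, D h \in Lfun P 2%:E,
      forall (a : R) (h k : V),
        {ae P, forall z, D (a *: h + k) z = a * D h z + D k z} &
      exists C : R, forall h, (L2norm P (D h) <= (C * `|h|)%:E)%E].

Definition is_frechet_L2 {V : normedModType R} (H : set V)
    (m : T -> R -> V -> R) (b0 : R) (eta0 : V)
    (Dbeta : R -> T -> R) (Deta : V -> T -> R) : Prop :=
  [/\ bounded_linear_L2 (V := R^o) Dbeta,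
      bounded_linear_L2 Deta &
      forall e : R, 0 < e ->
        \forall x \near (b0, eta0), H x.2 ->
          (L2norm P (fun z => m z x.1 x.2 - m z b0 eta0
                       - Dbeta (x.1 - b0) z - Deta (x.2 - eta0) z)%R
           <= (e * (`|x.1 - b0| + `|x.2 - eta0|))%:E)%E].

End frechet.

(* Main.v *)
(** Everything is computed in L2(nu) through the square-root densities.  For a
    regular submodel with score s the moment equation E_{P_t}[f_t] = 0,
    differentiated at t = 0, gives
      G * beta' + E_0[D_eta m_0 (eta')] + E_0[f_0 s] = 0,
    the boundedness of f_0 handling the change of measure and the uniform second
    moments allowing E_{P_t} to be replaced by E_0 in the difference quotient of
    f_t.  Orthogonality kills the middle term, so beta' = E_0[phi s] for the
    scores s of the dense class.  For an arbitrary submodel with score s, pick s'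
    in the dense class close to s: the Hellinger distance of the two submodels is
    at most |t| (|s - s'| + o(1)), so the Lipschitz property makes their
    difference quotients of beta agree up to a multiple of |s - s'|. *)
Require Import Defs.
From HB Require Import structures.
From mathcomp Require Import all_boot all_order all_algebra.
From mathcomp Require Import all_classical all_reals all_analysis.
From mathcomp Require Import measurable_realfun ring lra.

Set Implicit Arguments.
Unset Strict Implicit.
Unset Printing Implicit Defensive.
Import Order.TTheory GRing.Theory Num.Theory.
Import numFieldNormedType.Exports.

Local Open Scope classical_set_scope.
Local Open Scope ring_scope.

(** * Square-integrable real functions: the L2 seminorm and Cauchy-Schwarz *)

Section square_integrable.
Context {d : measure_display} {T : measurableType d} {R : realType}.
Variable mu : {measure set T -> \bar R}.
Implicit Types (f g : T -> R) (k : R).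

(** Real-valued form of membership in [Lfun mu 2%:E], the two being equivalent by [Lfun2_sqint] and
    [sqint_Lfun2]. It works for any measure, so that [nu] and the probabilities share one
    calculus. *)
Definition sqint f : Prop :=
  measurable_fun [set: T] f /\
  mu.-integrable [set: T] (EFin \o (fun z => f z ^+ 2)).

(** The real-valued integral sends an infinite value to 0, so this is the L2 seminorm only for
    [sqint] functions; the lemmas below therefore carry that hypothesis. *)
Definition nrm2 f : R := Num.sqrt (\int[mu]_z (f z ^+ 2)).

Lemma nrm2_ge0 f : 0 <= nrm2 f.
Proof. exact: sqrtr_ge0. Qed.

Lemma sqr_nrm2 f : nrm2 f ^+ 2 = \int[mu]_z (f z ^+ 2).
Proof. by rewrite sqr_sqrtr// Rintegral_ge0// => z _; exact: sqr_ge0. Qed.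

Lemma sqintM f g : sqint f -> sqint g ->
  mu.-integrable [set: T] (EFin \o (fun z => f z * g z)).
Proof.
move=> [mf If] [mg Ig].
apply: (@le_integrable _ _ _ mu _ measurableT _
  (EFin \o (fun z => f z ^+ 2 + g z ^+ 2))).
- by apply/measurable_EFinP; exact: measurable_funM.
- move=> z _ /=; rewrite lee_fin normrM (@ger0_norm _ (_ + _)); last first.
    by rewrite addr_ge0 ?sqr_ge0.
  rewrite -(real_normK (num_real (f z))) -(real_normK (num_real (g z))).
  have := sqr_ge0 (`|f z| - `|g z|); have := normr_ge0 (f z).
  by have := normr_ge0 (g z); nra.
- by have := integrableD measurableT If Ig.
Qed.

Lemma le_sqint f g k : measurable_fun [set: T] f -> sqint g ->
  (forall z, `|f z| <= k * `|g z|) -> sqint f.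
Proof.
move=> mf [mg Ig] fg; split=> //.
apply: (@le_integrable _ _ _ mu _ measurableT _
  (EFin \o (fun z => k ^+ 2 * g z ^+ 2))).
- by apply/measurable_EFinP; exact: measurable_funX.
- move=> z _ /=; rewrite lee_fin (@ger0_norm _ (k ^+ 2 * _)); last first.
    by rewrite mulr_ge0 ?sqr_ge0.
  rewrite ger0_norm ?sqr_ge0// -exprMn -(real_normK (num_real (f z))).
  rewrite -(real_normK (num_real (k * g z))) ler_sqr ?nnegrE ?normr_ge0//.
  by apply: (le_trans (fg z)); rewrite normrM ler_wpM2r ?ler_norm.
- by have := integrableZl measurableT (k ^+ 2) Ig.
Qed.

Lemma sqintZ k f : sqint f -> sqint (fun z => k * f z).
Proof.
move=> sf; apply: (le_sqint (k := `|k|) _ sf) => [|z].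
  by apply: measurable_funM => //; exact: sf.1.
by rewrite normrM.
Qed.

Lemma sqintD f g : sqint f -> sqint g -> sqint (fun z => f z + g z).
Proof.
move=> sf sg; split; first by apply: measurable_funD; [exact: sf.1|exact: sg.1].
have := integrableD measurableT (integrableD measurableT sf.2 sg.2)
  (integrableZl measurableT 2 (sqintM sf sg)).
apply: eq_integrable => // z _ /=.
by rewrite -EFinM -!EFinD; congr EFin; ring.
Qed.

Lemma sqintB f g : sqint f -> sqint g -> sqint (fun z => f z - g z).
Proof.
move=> sf sg; have := sqintD sf (sqintZ (-1) sg).
by under eq_fun do rewrite mulN1r.
Qed.

Lemma nrm2Z k f : sqint f -> nrm2 (fun z => k * f z) = `|k| * nrm2 f.
Proof.
move=> sf; rewrite /nrm2; under eq_Rintegral do rewrite exprMn.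
by rewrite RintegralZl//; [rewrite sqrtrM ?sqr_ge0// sqrtr_sqr|exact: sf.2].
Qed.

Lemma sqr_nrm2D f g : sqint f -> sqint g ->
  nrm2 (fun z => f z + g z) ^+ 2 =
  nrm2 f ^+ 2 + 2 * (\int[mu]_z (f z * g z)) + nrm2 g ^+ 2.
Proof.
move=> sf sg; rewrite !sqr_nrm2.
have Ifg := integrableZl measurableT 2 (sqintM sf sg).
have If := integrableD measurableT sf.2 Ifg.
transitivity (\int[mu]_z (f z ^+ 2 + 2 * (f z * g z) + g z ^+ 2)).
  by apply: eq_Rintegral => z _; ring.
rewrite RintegralD//; last exact: sg.2.
by rewrite RintegralD//; [rewrite RintegralZl//; exact: sqintM|exact: sf.2].
Qed.

(** Discriminant argument: the squared seminorm of [f + k * g] is a nonnegative polynomial in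
    [k]. *)
Lemma cauchy_schwarz f g : sqint f -> sqint g ->
  `|\int[mu]_z (f z * g z)| <= nrm2 f * nrm2 g.
Proof.
move=> sf sg.
have H k : 0 <= nrm2 f ^+ 2 + 2 * k * (\int[mu]_z (f z * g z))
    + k ^+ 2 * nrm2 g ^+ 2.
  have := sqr_ge0 (nrm2 (fun z => f z + k * g z)).
  rewrite sqr_nrm2D//; last exact: sqintZ.
  rewrite nrm2Z// exprMn real_normK ?num_real//.
  under [in X in X -> _]eq_Rintegral do rewrite mulrCA.
  by rewrite RintegralZl//; [rewrite mulrA|exact: sqintM].
move: H; set I := (\int[mu]_z (f z * g z)); set a := nrm2 f; set b := nrm2 g.
have a0 : 0 <= a := nrm2_ge0 f; have b0 : 0 <= b := nrm2_ge0 g.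
move=> H; rewrite -ler_sqr ?nnegrE ?mulr_ge0// real_normK ?num_real// exprMn.
(* If [b = 0] the polynomial is affine in [k]; with a nonzero slope the chosen [k] would give it the
   value -1. *)
have [b00|bn0] := eqVneq b 0.
  have [I0|In0] := eqVneq I 0; first by rewrite I0 b00 !expr0n mulr0.
  have := H (- (a ^+ 2 + 1) / (2 * I)); rewrite b00 expr0n/= !mulr0 addr0.
  have -> : 2 * (- (a ^+ 2 + 1) / (2 * I)) * I = - (a ^+ 2 + 1) by field.
  by lra.
have b2 : 0 < b ^+ 2 by rewrite exprn_gt0// lt_neqAle eq_sym bn0.
(* The minimiser of the quadratic. *)
have := H (- I / b ^+ 2).
have -> : a ^+ 2 + 2 * (- I / b ^+ 2) * I + (- I / b ^+ 2) ^+ 2 * b ^+ 2 =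
   (a ^+ 2 * b ^+ 2 - I ^+ 2) / b ^+ 2 by field.
by rewrite pmulr_lge0 ?invr_gt0// subr_ge0.
Qed.

Lemma ler_nrm2D f g : sqint f -> sqint g ->
  nrm2 (fun z => f z + g z) <= nrm2 f + nrm2 g.
Proof.
move=> sf sg; rewrite -ler_sqr ?nnegrE ?addr_ge0 ?nrm2_ge0// sqr_nrm2D//.
have := cauchy_schwarz sf sg; have := ler_norm (\int[mu]_z (f z * g z)).
by lra.
Qed.

Lemma ler_nrm2B f g : sqint f -> sqint g ->
  nrm2 (fun z => f z - g z) <= nrm2 f + nrm2 g.
Proof.
move=> sf sg; have := ler_nrm2D sf (sqintZ (-1) sg).
rewrite nrm2Z// normrN1 mul1r.
rewrite (_ : (fun z => f z + -1 * g z) = (fun z => f z - g z))//.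
by apply/funext => z; rewrite mulN1r.
Qed.

Lemma le_nrm2 f g k : measurable_fun [set: T] f -> sqint g -> 0 <= k ->
  (forall z, `|f z| <= k * `|g z|) -> nrm2 f <= k * nrm2 g.
Proof.
move=> mf sg k0 fg; rewrite -(ger0_norm k0) -nrm2Z//.
rewrite /nrm2 ler_wsqrtr// le_Rintegral//.
- exact: (le_sqint mf sg fg).2.
- exact: (sqintZ k sg).2.
move=> z _; rewrite -(real_normK (num_real (f z))).
rewrite -(real_normK (num_real (k * g z))) ler_sqr ?nnegrE ?normr_ge0//.
by rewrite normrM (ger0_norm k0).
Qed.

Lemma Lfun2_sqint f : f \in Lfun mu 2%:E -> sqint f.
Proof.
move=> fL; split; last exact: Lfun2_integrable_sqr.
by move: fL; rewrite inE => /andP[+ _]; rewrite inE.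
Qed.

Lemma fin_sqint f : measurable_fun [set: T] f ->
  (\int[mu]_z (f z ^+ 2)%:E < +oo)%E -> sqint f.
Proof.
move=> mf foo; split=> //; apply/integrableP; split.
  by apply/measurable_EFinP; exact: measurable_funX.
by under eq_integral do rewrite /= ger0_norm ?sqr_ge0//.
Qed.

Lemma EFin_sqr_nrm2 f : sqint f -> (nrm2 f ^+ 2)%:E = (\int[mu]_z (f z ^+ 2)%:E)%E.
Proof.
move=> sf; rewrite sqr_nrm2 fineK//.
by apply: integrable_fin_num => //; exact: sf.2.
Qed.

Lemma Lnorm_nrm2 f : sqint f -> 'N[mu]_2%:E[EFin \o f]%E = (nrm2 f)%:E.
Proof.
move=> sf; rewrite unlock.
rewrite (eq_integral (fun z => (f z ^+ 2)%:E)); last first.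
  by move=> z _ /=; rewrite powR_mulrn// real_normK ?num_real.
rewrite -EFin_sqr_nrm2// poweR_EFin powR12_sqrt ?sqr_ge0// sqrtr_sqr.
by rewrite ger0_norm ?nrm2_ge0.
Qed.

Lemma sqint_Lfun2 f : sqint f -> f \in Lfun mu 2%:E.
Proof.
move=> sf; rewrite inE; apply/andP; split; rewrite inE/=; first exact: sf.1.
by rewrite /finite_norm Lnorm_nrm2// ltry.
Qed.

End square_integrable.

(** * Means under a probability measure and their L2 bounds *)

Section probability_mean.
Context {d : measure_display} {T : measurableType d} {R : realType}.
Variable P : probability T R.
Implicit Types (f g : T -> R) (k M : R).

Lemma sqint_cst k : sqint P (cst k).
Proof.
split=> //; have := finite_measure_integrable_cst P (k ^+ 2) (@measurableT _ T).
by apply: eq_integrable.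
Qed.

Lemma nrm2_cst1 : nrm2 P (cst 1) = 1.
Proof.
rewrite /nrm2; under eq_Rintegral do rewrite expr1n.
rewrite Rintegral_cst// mul1r (_ : fine _ = 1) ?sqrtr1//.
exact: (congr1 fine (probability_setT P)).
Qed.

Lemma sqint_bounded f M : measurable_fun [set: T] f ->
  (forall z, `|f z| <= M) -> sqint P f.
Proof.
move=> mf fM; apply: (le_sqint (k := M) mf (sqint_cst 1)) => z.
by rewrite normr1 mulr1.
Qed.

Lemma nrm2_bounded f M : measurable_fun [set: T] f ->
  (forall z, `|f z| <= M) -> nrm2 P f <= M.
Proof.
move=> mf fM; rewrite -[leRHS]mulr1 -nrm2_cst1.
apply: le_nrm2 => //; first exact: sqint_cst.
  by rewrite (le_trans _ (fM point)).
by move=> z; rewrite normr1 mulr1.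
Qed.

Lemma sqint_integrable f : sqint P f -> P.-integrable [set: T] (EFin \o f).
Proof.
move=> sf; apply: eq_integrable (sqintM sf (sqint_cst 1)) => // z _ /=.
by rewrite mulr1.
Qed.

Lemma ler_mean_nrm2 f : sqint P f -> `|\int[P]_z f z| <= nrm2 P f.
Proof.
move=> sf; have := cauchy_schwarz sf (sqint_cst 1).
by rewrite nrm2_cst1 mulr1; under eq_Rintegral do rewrite mulr1.
Qed.

Lemma fine_expectation f : fine 'E_P[f]%E = \int[P]_z f z.
Proof. by rewrite unlock. Qed.

End probability_mean.

(** * Square-root densities and change of measure *)

Section root_density.
Context {d : measure_display} {T : measurableType d} {R : realType}.
Variable nu : {sigma_finite_measure set T -> \bar R}.
Implicit Types (P Q : probability T R) (f g : T -> R).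

Definition root_density P (z : T) : R := Num.sqrt (density nu P z).

Section dominated.
Variable P : probability T R.
Hypothesis Pnu : P `<< nu.

Lemma measurable_root_density : measurable_fun [set: T] (root_density P).
Proof.
apply: (measurableT_comp (f := @Num.sqrt R)).
  exact: continuous_measurable_fun (@sqrt_continuous R).
apply: (measurableT_comp (f := fine)); first exact: fine_measurable.
exact: (measurable_int _ (Radon_Nikodym_integrable _)).
Qed.

(** Change of measure from [P] to [nu]. The change of variables is available for a version of the
    derivative that is finite and nonnegative everywhere; it agrees [nu]-almost everywhere with the
    one inside [density], so there the squared root gives back the density. *)
Lemma integral_root_density f : measurable_fun [set: T] f ->
  (forall z, 0 <= f z) ->
  (\int[nu]_z (f z * root_density P z ^+ 2)%:E = \int[P]_z (f z)%:E)%E.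
Proof.
move=> mf f0.
rewrite -(Radon_Nikodym_SigmaFinite.change_of_variables Pnu)//; last first.
  exact/measurable_EFinP.
apply: ae_eq_integral => //.
- apply/measurable_EFinP; apply: measurable_funM => //.
  by apply: measurable_funX; exact: measurable_root_density.
- apply: emeasurable_funM; first exact/measurable_EFinP.
  exact: (measurable_int _ (Radon_Nikodym_SigmaFinite.f_integrable Pnu)).
apply: filterS (ae_eq_Radon_Nikodym_SigmaFinite Pnu measurableT) => z /= + _.
move=> /(_ Logic.I) E; rewrite EFinM /root_density /density/= -E.
rewrite sqr_sqrtr ?fineK//.
  exact: Radon_Nikodym_SigmaFinite.f_fin_num.
by apply: fine_ge0; exact: Radon_Nikodym_SigmaFinite.f_ge0.
Qed.

Lemma sqint_root_density f : sqint P f ->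
  sqint nu (fun z => f z * root_density P z).
Proof.
move=> sf; apply: fin_sqint.
  by apply: measurable_funM; [exact: sf.1|exact: measurable_root_density].
under eq_integral do rewrite exprMn.
rewrite integral_root_density.
- by rewrite -EFin_sqr_nrm2// ltry.
- by apply: measurable_funX; exact: sf.1.
- by move=> z; exact: sqr_ge0.
Qed.

Lemma nrm2_root_density f : sqint P f ->
  nrm2 nu (fun z => f z * root_density P z) = nrm2 P f.
Proof.
move=> sf; rewrite /nrm2 /Rintegral; congr (Num.sqrt (fine _)).
under eq_integral do rewrite exprMn.
rewrite integral_root_density//.
- by apply: measurable_funX; exact: sf.1.
- by move=> z; exact: sqr_ge0.
Qed.

(** Polarisation: multiplication by the root density is a linear isometry from L2(P) to L2(nu),
    hence preserves inner products. *)
Lemma Rintegral_root_density f g : sqint P f -> sqint P g ->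
  \int[P]_z (f z * g z) =
  \int[nu]_z (f z * root_density P z * (g z * root_density P z)).
Proof.
move=> sf sg; have sq := sqint_root_density.
have := sqr_nrm2D (sq _ sf) (sq _ sg); rewrite !nrm2_root_density//.
under [in X in X -> _]eq_fun do rewrite -mulrDl.
rewrite nrm2_root_density; last exact: sqintD.
by rewrite sqr_nrm2D// => /addIr/addrI; lra.
Qed.

Lemma mean_root_density f : sqint P f ->
  \int[P]_z f z = \int[nu]_z (f z * root_density P z * root_density P z).
Proof.
move=> sf; have := Rintegral_root_density sf (sqint_cst P 1).
under eq_Rintegral do rewrite mulr1.
by move=> ->; apply: eq_Rintegral => z _; rewrite mul1r.
Qed.

Lemma sqint_root_density1 : sqint nu (root_density P).
Proof.
have := sqint_root_density (sqint_cst P 1).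
by under eq_fun do rewrite mul1r.
Qed.

End dominated.

(** Factor the difference of densities as the sum times the difference of their square roots, then
    apply Cauchy-Schwarz to each summand. Only second moments of [f] enter, so [f] may later vary
    with the submodel parameter. *)
Lemma ler_mean_diff P Q f : P `<< nu -> Q `<< nu -> sqint P f -> sqint Q f ->
  `|\int[P]_z f z - \int[Q]_z f z| <=
  (nrm2 P f + nrm2 Q f) *
    nrm2 nu (fun z => root_density P z - root_density Q z).
Proof.
move=> Pnu Qnu Pf Qf.
have sP := sqint_root_density Pnu Pf; have sQ := sqint_root_density Qnu Qf.
have dP := sqint_root_density1 Pnu; have dQ := sqint_root_density1 Qnu.
have sd := sqintB dP dQ.
have -> : \int[P]_z f z - \int[Q]_z f z =
    \int[nu]_z ((f z * root_density P z) * (root_density P z - root_density Q z))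
  + \int[nu]_z ((f z * root_density Q z) * (root_density P z - root_density Q z)).
  rewrite (mean_root_density Pnu Pf) (mean_root_density Qnu Qf).
  rewrite -RintegralB//; [|exact: sqintM..].
  rewrite -RintegralD//; [|exact: sqintM..].
  by apply: eq_Rintegral => z _; ring.
apply: (le_trans (ler_normD _ _)).
rewrite mulrDl -(nrm2_root_density Pnu Pf) -(nrm2_root_density Qnu Qf).
by rewrite lerD// cauchy_schwarz.
Qed.

Lemma hellingerE P Q : hellinger nu P Q =
  Num.sqrt 2^-1 * nrm2 nu (fun z => root_density P z - root_density Q z).
Proof. by rewrite /hellinger sqrtrM// invr_ge0. Qed.

End root_density.

Lemma cvg_dist_le {R : realType} {I : Type} {F : set_system I}
    {FF : Filter F} (f g : I -> R) (l : R) :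
  (\forall t \near F, `|f t - l| <= g t) -> g @ F --> 0 -> f @ F --> l.
Proof.
move=> fg g0; apply/cvgrPdist_lt => e e0.
move/cvgrPdist_lt/(_ e e0): g0; apply: filterS2 fg => t fg.
by rewrite sub0r normrN distrC => /(le_lt_trans (ler_norm _)); exact: le_lt_trans.
Qed.

(** * Quadratic mean differentiability along one regular submodel *)

Section quadratic_mean_differentiability.
Context {d : measure_display} {T : measurableType d} {R : realType}.
Variables (nu : {sigma_finite_measure set T -> \bar R})
  (model : set (probability T R)) (P0 : probability T R)
  (eps : R) (Pt : R -> probability T R) (s : T -> R).
Hypotheses (dominated : forall P, model P -> P `<< nu) (P0_model : model P0)
  (reg : regular_submodel nu model P0 eps Pt s).

Local Notation q t := (root_density nu (Pt t)).
Local Notation q0 := (root_density nu P0).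

(** The remainder in the first-order expansion of the root density; regularity says that its L2(nu)
    norm vanishes in the limit. *)
Definition qmd_residual (t : R) (z : T) : R :=
  (q t z - q0 z) / t - 2^-1 * s z * q0 z.

Local Notation r := qmd_residual.

Lemma near_submodel : \forall t \near (0 : R)^', `|t| < eps.
Proof. by case: reg => eps0 _ _ _ _; exact: dnbhs0_lt. Qed.

Lemma submodel_dominated t : `|t| < eps -> Pt t `<< nu.
Proof. by move=> te; apply: dominated; case: reg => _ + _ _ _; exact. Qed.

Lemma sqint_score : sqint P0 s.
Proof. by case: reg => _ _ _ [] /Lfun2_sqint. Qed.

Let P0nu : P0 `<< nu := dominated P0_model.

Lemma sqint_half_score : sqint nu (fun z => 2^-1 * (s z * q0 z)).
Proof. exact: (sqintZ _ (sqint_root_density P0nu sqint_score)). Qed.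

Lemma nrm2_half_score :
  nrm2 nu (fun z => 2^-1 * (s z * q0 z)) = 2^-1 * nrm2 P0 s.
Proof.
rewrite nrm2Z; last exact: (sqint_root_density P0nu sqint_score).
by rewrite (nrm2_root_density P0nu sqint_score) ger0_norm ?invr_ge0.
Qed.

Lemma sqint_root_diff t : `|t| < eps -> sqint nu (fun z => q t z - q0 z).
Proof.
by move=> te; apply: sqintB; apply: sqint_root_density1 => //;
  exact: submodel_dominated.
Qed.

Lemma sqint_residual t : `|t| < eps -> sqint nu (r t).
Proof.
move=> te; have := sqintB (sqintZ t^-1 (sqint_root_diff te)) sqint_half_score.
by congr sqint; apply/funext => z; rewrite /r; ring.
Qed.

Lemma residual_cvg0 : nrm2 nu (r t) @[t --> (0 : R)^'] --> (0 : R).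
Proof.
case: reg => _ _ _ _ /fine_cvg h.
rewrite -[X in _ --> X](@sqrtr0 R); apply: continuous_cvg.
  exact: sqrt_continuous.
exact: h.
Qed.

Lemma root_diffE t z : t != 0 ->
  q t z - q0 z = t * (r t z + 2^-1 * (s z * q0 z)).
Proof. by move=> t0; rewrite /r; field. Qed.

(** By [root_diffE] the difference is [t] times a function whose norm stays bounded near 0. *)
Lemma root_diff_cvg0 :
  nrm2 nu (fun z => q t z - q0 z) @[t --> (0 : R)^'] --> (0 : R).
Proof.
apply: (cvg_dist_le (g := fun t => `|t| * (nrm2 nu (r t) + 2^-1 * nrm2 P0 s))).
  near=> t.
  have te : `|t| < eps by near: t; exact: near_submodel.
  have t0 : t != 0 by near: t; exact: nbhs_dnbhs_neq.
  rewrite subr0 ger0_norm ?nrm2_ge0// -nrm2_half_score.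
  under eq_fun do rewrite root_diffE//.
  have sr := sqint_residual te; have sh := sqint_half_score.
  rewrite nrm2Z; last exact: sqintD.
  by rewrite ler_wpM2l// ler_nrm2D.
rewrite -[X in _ --> X](mul0r (0 + 2^-1 * nrm2 P0 s)); apply: cvgM.
  rewrite -[X in _ --> X](@normr0 _ R); apply: cvg_norm.
  exact: cvg_within.
by apply: cvgD; [exact: residual_cvg0|exact: cvg_cst].
Unshelve. all: by end_near. Qed.

(** The mean of a fixed bounded function is differentiable along the submodel, and its derivative is
    the inner product with the score. Boundedness controls the second moment of [f] under every
    [Pt t] by the same constant. *)
Lemma bounded_mean_score (f : T -> R) (M : R) : measurable_fun [set: T] f ->
  (forall z, `|f z| <= M) ->
  (\int[Pt t]_z f z - \int[P0]_z f z) / t @[t --> (0 : R)^'] -->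
  \int[P0]_z (f z * s z).
Proof.
move=> mf fM; have M0 : 0 <= M := le_trans (normr_ge0 _) (fM point).
pose g t := 2 * M * nrm2 nu (r t) +
  M * nrm2 nu (fun z => q t z - q0 z) * (2^-1 * nrm2 P0 s).
apply: (cvg_dist_le (g := g)); last first.
  rewrite -[X in _ --> X](_ : 2 * M * 0 + M * 0 * (2^-1 * nrm2 P0 s) = 0); last first.
    by rewrite !mulr0 mul0r addr0.
  apply: cvgD; first by apply: cvgMl_tmp; exact: residual_cvg0.
  apply: cvgMr_tmp; apply: cvgMl_tmp; exact: root_diff_cvg0.
near=> t.
have te : `|t| < eps by near: t; exact: near_submodel.
have t0 : t != 0 by near: t; exact: nbhs_dnbhs_neq.
have tnu := submodel_dominated te.
have ft := sqint_bounded (Pt t) mf fM; have f0 := sqint_bounded P0 mf fM.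
have ftq := sqint_root_density tnu ft; have f0q := sqint_root_density P0nu f0.
have sr := sqint_residual te; have sh := sqint_half_score.
have sd := sqint_root_diff te.
have ss := sqint_score; have ssq := sqint_root_density P0nu ss.
have fd : sqint nu (fun z => f z * (q t z - q0 z)).
  apply: (le_sqint (k := M) _ sd) => [|z].
    by apply: measurable_funM => //; exact: sd.1.
  by rewrite normrM ler_wpM2r.
(* Write the density difference as [(q t + q0) * (q t - q0)] and expand the second factor divided by
   [t] as [r t] plus half the score term. Subtracting [f * s * q0 ^+ 2] leaves [q t - q0] in front
   of the half score, so all three integrals are small. *)
have -> : (\int[Pt t]_z f z - \int[P0]_z f z) / t - \int[P0]_z (f z * s z) =
    \int[nu]_z (f z * q t z * r t z) + \int[nu]_z (f z * q0 z * r t z)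
    + \int[nu]_z (f z * (q t z - q0 z) * (2^-1 * (s z * q0 z))).
  rewrite (mean_root_density tnu ft) (mean_root_density P0nu f0).
  rewrite (Rintegral_root_density P0nu f0 ss).
  have I1 := sqintM ftq (sqint_root_density1 tnu).
  have I2 := sqintM f0q (sqint_root_density1 P0nu).
  have I12 := integrableB measurableT I1 I2.
  have I3 := sqintM f0q ssq.
  have I4 := sqintM ftq sr.
  have I5 := sqintM f0q sr.
  have I6 := sqintM fd sh.
  rewrite [_ / t]mulrC -RintegralB// -RintegralZl//.
  rewrite -RintegralB//; last by have := integrableZl measurableT t^-1 I12.
  rewrite -RintegralD// -RintegralD//; last by
    have := integrableD measurableT I4 I5.
  by apply: eq_Rintegral => z _; rewrite /r; field.
apply: (le_trans (ler_normD _ _)); apply: lerD.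
  apply: (le_trans (ler_normD _ _)); rewrite -mulrA mulr_natl mulr2n.
  apply: lerD; [apply: (le_trans (cauchy_schwarz ftq sr))|
                apply: (le_trans (cauchy_schwarz f0q sr))].
    by rewrite (nrm2_root_density tnu ft) ler_wpM2r ?nrm2_ge0// nrm2_bounded.
  by rewrite (nrm2_root_density P0nu f0) ler_wpM2r ?nrm2_ge0// nrm2_bounded.
apply: (le_trans (cauchy_schwarz fd sh)).
rewrite nrm2_half_score ler_wpM2r ?mulr_ge0 ?invr_ge0 ?nrm2_ge0//.
apply: (le_nrm2 fd.1 sd M0) => z.
by rewrite normrM ler_wpM2r.
Unshelve. all: by end_near. Qed.

End quadratic_mean_differentiability.

(** * Difference quotients and a chain rule along curves *)

Lemma cvg_norm_sub {R : realType} {V : normedModType R} {I : Type}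
    {F : set_system I} {FF : Filter F} (f : I -> V) (l : V) :
  f @ F --> l -> `|l - f t| @[t --> F] --> (0 : R).
Proof.
move=> fl; apply/cvgrPdist_lt => e e0; move/cvgrPdist_lt/(_ e e0) : fl.
by apply: filterS => t; rewrite sub0r normrN normr_id.
Qed.

Lemma cvg_difference_quotient {R : realType} {V : normedModType R}
    (v : R -> V) (v0 dv : V) :
  t^-1 *: (v t - v0) @[t --> (0 : R)^'] --> dv -> v t @[t --> (0 : R)^'] --> v0.
Proof.
move=> vdv; have h : t *: (t^-1 *: (v t - v0)) + v0 @[t --> (0 : R)^'] --> v0.
  rewrite -[X in _ --> X]add0r -[X in _ --> X + _](scale0r dv).
  by apply: cvgD (cvg_cst _); apply: cvgZ => //; exact: cvg_within.
apply: cvg_trans h; apply: near_eq_cvg; near=> t.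
have t0 : t != 0 by near: t; exact: nbhs_dnbhs_neq.
by rewrite scalerA divff// scale1r subrK.
Unshelve. all: by end_near. Qed.

Lemma cvg_difference_quotientR {R : realType} (b : R -> R) (b0 db : R) :
  (b t - b0) / t @[t --> (0 : R)^'] --> db -> b t @[t --> (0 : R)^'] --> b0.
Proof.
move=> bdb; apply: (@cvg_difference_quotient _ R^o _ _ db).
have -> // : (fun t => t^-1 *: (b t - b0 : R^o)) = (fun t => (b t - b0) / t).
by apply/funext => t; rewrite mulrC.
Qed.

(** Chain rule for a differentiability that is only required on [H]: the curve [v] must eventually
    stay in [H]. It serves both straight lines in a direction [h] and the coordinates of a
    submodel. *)
Lemma frechet_difference_quotient {R : realType} {V : normedModType R}
    (H : set V) (F : R -> V -> R) (b0 : R) (e0 : V) (G : R) (L : V -> R) (C : R)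
    (b : R -> R) (v : R -> V) (db : R) (dv : V) :
  (forall a h k, L (a *: h + k) = a * L h + L k) ->
  (forall h, `|L h| <= C * `|h|) ->
  (forall e : R, 0 < e -> \forall x \near (b0, e0), H x.2 ->
     `|F x.1 x.2 - F b0 e0 - G * (x.1 - b0) - L (x.2 - e0)| <=
       e * (`|x.1 - b0| + `|x.2 - e0|)) ->
  (\forall t \near (0 : R)^', H (v t)) ->
  (b t - b0) / t @[t --> (0 : R)^'] --> db ->
  t^-1 *: (v t - e0) @[t --> (0 : R)^'] --> dv ->
  (F (b t) (v t) - F b0 e0) / t @[t --> (0 : R)^'] --> G * db + L dv.
Proof.
move=> Llin LC dF Hv bdb vdv.
have L0 : L 0 = 0.
  by have := Llin 1 0 0; rewrite scaler0 addr0 mul1r => /eqP;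
     rewrite -subr_eq0 opprD addrA subrr sub0r oppr_eq0 => /eqP.
have LZ a h : L (a *: h) = a * L h.
  by have := Llin a h 0; rewrite addr0 L0 addr0.
have LB h k : L (h - k) = L h - L k.
  by rewrite -[h - k]addrC -scaleN1r Llin mulN1r addrC.
have bv : (b t, v t) @[t --> (0 : R)^'] --> (b0, e0).
  exact: cvg_pair (cvg_difference_quotientR bdb) (cvg_difference_quotient vdv).
(* Bounds the sum of the two difference quotients in norm once each is within 1 of its limit; the
   Frechet remainder divided by [t] is then at most [e / 2]. *)
pose K := `|db| + `|dv| + 2.
have K0 : 0 < K by rewrite ltr_wpDl ?addr_ge0.
apply/cvgrPdist_le => e e0'.
pose g t := `|G| * `|db - (b t - b0) / t| + C * `|dv - t^-1 *: (v t - e0)|.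
have gcvg : g t @[t --> (0 : R)^'] --> (0 : R).
  rewrite -[X in _ --> X](_ : `|G| * 0 + C * 0 = 0); last by rewrite !mulr0 addr0.
  have c1 : `|db - (b t - b0) / t| @[t --> (0 : R)^'] --> (0 : R).
    exact: cvg_norm_sub.
  have c2 : `|dv - t^-1 *: (v t - e0)| @[t --> (0 : R)^'] --> (0 : R).
    exact: cvg_norm_sub.
  exact: cvgD (cvgMl_tmp c1) (cvgMl_tmp c2).
have e2 : 0 < e / 2 by rewrite divr_gt0.
have eK : 0 < e / 2 / K by rewrite divr_gt0.
have {}dF := bv _ (dF _ eK).
near=> t.
have t0 : t != 0 by near: t; exact: nbhs_dnbhs_neq.
have Ht : H (v t) by near: t.
have gt : g t <= e / 2.
  have : `|0 - g t| <= e / 2 by near: t; move/cvgrPdist_le : gcvg; exact.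
  by rewrite sub0r normrN; apply: le_trans; exact: ler_norm.
have bt : `|db - (b t - b0) / t| <= 1 by near: t; move/cvgrPdist_le : bdb; exact.
have vt : `|dv - t^-1 *: (v t - e0)| <= 1.
  by near: t; move/cvgrPdist_le : vdv; exact.
have rem : `|F (b t) (v t) - F b0 e0 - G * (b t - b0) - L (v t - e0)| <=
    e / 2 / K * (`|b t - b0| + `|v t - e0|) by near: t; apply: filterS2 Hv dF => t Ht; exact.
set rm := F (b t) (v t) - F b0 e0 - G * (b t - b0) - L (v t - e0) in rem.
have -> : G * db + L dv - (F (b t) (v t) - F b0 e0) / t =
    G * (db - (b t - b0) / t) + L (dv - t^-1 *: (v t - e0)) - rm / t.
  by rewrite LB LZ /rm; field.
apply: (le_trans (ler_normB _ _)); rewrite [leRHS]splitr; apply: lerD.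
  apply: le_trans gt; apply: (le_trans (ler_normD _ _)).
  by rewrite normrM lerD2l.
have bt' : `|b t - b0| / `|t| <= `|db| + 1.
  rewrite -normfV -normrM -[X in `|X|](subKr db).
  by apply: (le_trans (ler_normB _ _)); rewrite lerD2l.
have vt' : `|v t - e0| / `|t| <= `|dv| + 1.
  rewrite mulrC -normfV -normrZ -[X in `|X|](subKr dv).
  by apply: (le_trans (ler_normB _ _)); rewrite lerD2l.
rewrite normrM normfV.
apply: (@le_trans _ _ (e / 2 / K * K)); last by rewrite divfK ?gt_eqF.
apply: (@le_trans _ _ (e / 2 / K * (`|b t - b0| + `|v t - e0|) / `|t|)).
  by rewrite ler_wpM2r ?invr_ge0.
rewrite -(mulrA (e / 2 / K)) (ler_wpM2l (ltW eK))// mulrDl.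
by apply: (le_trans (lerD bt' vt')); rewrite /K; lra.
Unshelve. all: by end_near. Qed.

(** * From Frechet differentiability in L2 to differentiability of the mean *)

Section frechet_mean.
Context {d : measure_display} {T : measurableType d} {R : realType}.
Variable P : probability T R.

(** The linearity of [D] holds only almost everywhere for each choice of arguments; integration
    turns it into an exact identity. *)
Lemma bounded_linear_mean_linear {V : normedModType R} (D : V -> T -> R) :
  bounded_linear_L2 P D -> forall (a : R) (h k : V),
  \int[P]_z D (a *: h + k) z = a * \int[P]_z D h z + \int[P]_z D k z.
Proof.
move=> [DL Dlin _] a h k.
have sD l : sqint P (D l) by apply: Lfun2_sqint; exact: DL.
have sah := sqintZ a (sD h).
rewrite -RintegralZl//; last exact: sqint_integrable.
rewrite -RintegralD//; [|exact: sqint_integrable..].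
rewrite /Rintegral; congr fine; apply: ae_eq_integral => //.
- by apply/measurable_EFinP; exact: (sD _).1.
- by apply/measurable_EFinP; exact: (sqintD sah (sD k)).1.
- by apply: filterS (Dlin a h k) => z /= ->.
Qed.

Lemma bounded_linear_mean_bounded {V : normedModType R} (D : V -> T -> R) :
  bounded_linear_L2 P D ->
  exists C : R, forall h, `|\int[P]_z D h z| <= C * `|h|.
Proof.
move=> [DL _ [C DC]]; exists C => h.
have sD := Lfun2_sqint (DL h).
apply: (le_trans (ler_mean_nrm2 sD)).
by rewrite -lee_fin -Lnorm_nrm2//; exact: DC.
Qed.

(** A mean is bounded by the L2 norm, so the L2 remainder bound passes to the means; the derivative
    in the first coordinate becomes multiplication by the mean of [Dbeta 1]. *)
Lemma frechet_mean {V : normedModType R} (H : set V)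
    (m : T -> R -> V -> R) (b0 : R) (e0 : V)
    (Dbeta : R -> T -> R) (Deta : V -> T -> R) :
  is_frechet_L2 P H m b0 e0 Dbeta Deta ->
  H e0 -> (forall b e, H e -> sqint P (fun z => m z b e)) ->
  forall e : R, 0 < e -> \forall x \near (b0, e0), H x.2 ->
    `|\int[P]_z m z x.1 x.2 - \int[P]_z m z b0 e0
       - (\int[P]_z Dbeta 1 z) * (x.1 - b0) - \int[P]_z Deta (x.2 - e0) z| <=
      e * (`|x.1 - b0| + `|x.2 - e0|).
Proof.
move=> [Db De dm] He0 sm e e0'.
have sDe h : sqint P (Deta h) by case: De => DL _ _; exact: Lfun2_sqint (DL h).
have sDb h : sqint P (Dbeta h) by case: Db => DL _ _; exact: Lfun2_sqint (DL h).
apply: filterS (dm e e0') => -[b v] /= + Hv => /(_ Hv).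
set r := (X in L2norm P X); move=> rle.
have lin := bounded_linear_mean_linear Db.
have Db0 : \int[P]_z Dbeta 0 z = 0.
  have := lin 1 0 0; rewrite scaler0 addr0 mul1r => /eqP.
  by rewrite -subr_eq0 opprD addrA subrr sub0r oppr_eq0 => /eqP.
have Db1 : \int[P]_z Dbeta (b - b0) z = (\int[P]_z Dbeta 1 z) * (b - b0).
  have := lin (b - b0) 1 0; rewrite Db0 !addr0 mulrC => <-.
  by congr (Rintegral _ _ (Dbeta _)); rewrite /GRing.scale/= mulr1.
have s1 := sqintB (sm b v Hv) (sm b0 e0 He0).
have s2 := sqintB s1 (sDb (b - b0)).
have s3 : sqint P r := sqintB s2 (sDe (v - e0)).
rewrite -Db1 -RintegralB//; [|by apply: sqint_integrable; exact: sm..].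
rewrite -RintegralB//; [|exact: sqint_integrable..].
rewrite -RintegralB//; [|exact: sqint_integrable..].
apply: (le_trans (ler_mean_nrm2 s3)).
by rewrite -lee_fin -Lnorm_nrm2.
Qed.

End frechet_mean.

(** * Differentiating the moment equation along a submodel *)

(** With [g t] the difference quotient of [f], the equations [E_t[f t] = 0] and [E_0[f0] = 0] give
    [E_0[g t] = (E_0 - E_t)[g t] - (E_t - E_0)[f0] / t]. The first term vanishes in the limit and
    the second converges by [bounded_mean_score]. *)
Lemma moment_equation_derivative {d : measure_display} {T : measurableType d}
    {R : realType} (nu : {sigma_finite_measure set T -> \bar R})
    (model : set (probability T R)) (P0 : probability T R) (eps : R)
    (Pt : R -> probability T R) (s : T -> R) (f : R -> T -> R) (f0 df0 : T -> R)
    (M delta C l : R) :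
  (forall P, model P -> P `<< nu) -> model P0 ->
  regular_submodel nu model P0 eps Pt s ->
  measurable_fun [set: T] f0 -> (forall z, `|f0 z| <= M) ->
  \int[P0]_z f0 z = 0 ->
  (forall t, `|t| < eps -> sqint P0 (f t)) ->
  (\forall t \near (0 : R)^', \int[Pt t]_z f t z = 0) ->
  sqint P0 df0 ->
  'E_P0[(fun z => ((f t z - f0 z) / t - df0 z) ^+ 2)%R]%E
    @[t --> (0 : R)^'] --> 0%E ->
  0 < delta ->
  (forall t : R, 0 < `|t| < delta ->
    ('E_(Pt t)[(fun z => ((f t z - f0 z) / t) ^+ 2)%R] <= C%:E)%E) ->
  (\int[P0]_z f t z - \int[P0]_z f0 z) / t @[t --> (0 : R)^'] --> l ->
  l = - \int[P0]_z (f0 z * s z).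
Proof.
move=> dom P0m reg mf0 f0M Ef0 sf Eft sdf fdf delta0 fC fl.
pose g t z := t^-1 * (f t z - f0 z).
have gE t : g t = fun z => (f t z - f0 z) / t.
  by apply/funext => z; rewrite /g mulrC.
have sf0 := sqint_bounded P0 mf0 f0M.
have sg0 t : `|t| < eps -> sqint P0 (g t).
  by move=> te; apply: sqintZ; apply: sqintB => //; exact: sf.
have sgt t : `|t| < eps -> 0 < `|t| < delta -> sqint (Pt t) (g t).
  move=> te td; apply: fin_sqint; first exact: (sg0 _ te).1.
  by have := fC _ td; rewrite unlock gE => /le_lt_trans; apply; exact: ltry.
have ngt t : `|t| < eps -> 0 < `|t| < delta ->
    nrm2 (Pt t) (g t) <= Num.sqrt C.
  move=> te td; rewrite ler_wsqrtr// -sqr_nrm2 -lee_fin.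
  rewrite (EFin_sqr_nrm2 (sgt _ te td)) gE.
  by have := fC _ td; rewrite unlock.
have gdf : nrm2 P0 (fun z => g t z - df0 z) @[t --> (0 : R)^'] --> (0 : R).
  have /fine_cvg h := fdf.
  rewrite -[X in _ --> X](@sqrtr0 R); apply: continuous_cvg.
    exact: sqrt_continuous.
  apply: cvg_trans h; apply: near_eq_cvg; apply: nearW => t /=.
  by rewrite fine_expectation gE.
(* By [ler_mean_diff] it suffices that [g t] have bounded second moments under both measures: under
   [Pt t] by the uniform bound [C], under [P0] because [g t] is eventually within 1 of [df0]. *)
have D0 : (\int[P0]_z g t z - \int[Pt t]_z g t z) @[t --> (0 : R)^'] --> (0 : R).
  apply: (cvg_dist_le (g := fun t => (Num.sqrt C + (1 + nrm2 P0 df0)) *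
    nrm2 nu (fun z => root_density nu (Pt t) z - root_density nu P0 z))).
    near=> t.
    have te : `|t| < eps by near: t; exact: (near_submodel reg).
    have t0 : t != 0 by near: t; exact: nbhs_dnbhs_neq.
    have td : 0 < `|t| < delta.
      by rewrite normr_gt0 t0/=; near: t; exact: dnbhs0_lt.
    rewrite subr0 distrC.
    have tnu := submodel_dominated dom reg te.
    apply: (le_trans (ler_mean_diff tnu (dom _ P0m) (sgt _ te td) (sg0 _ te))).
    rewrite ler_wpM2r ?nrm2_ge0// lerD ?ngt//.
    have sgd := sqintB (sg0 _ te) sdf.
    have := ler_nrm2D sgd sdf; under [in X in X -> _]eq_fun do rewrite subrK.
    move/le_trans; apply; rewrite lerD2r.
    have : `|0 - nrm2 P0 (fun z => g t z - df0 z)| <= 1.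
      by near: t; move/cvgrPdist_le : gdf; exact.
    by rewrite sub0r normrN; apply: le_trans; exact: ler_norm.
  rewrite -[X in _ --> X](mulr0 (Num.sqrt C + (1 + nrm2 P0 df0))).
  by apply: cvgMl_tmp; exact: (root_diff_cvg0 dom P0m reg).
have D1 := bounded_mean_score dom P0m reg mf0 f0M.
have D : (\int[P0]_z g t z - \int[Pt t]_z g t z -
    (\int[Pt t]_z f0 z - \int[P0]_z f0 z) / t) @[t --> (0 : R)^'] -->
    - \int[P0]_z (f0 z * s z).
  by rewrite -[X in _ --> X]sub0r; exact: cvgB D0 D1.
have {}D : (\int[P0]_z f t z - \int[P0]_z f0 z) / t @[t --> (0 : R)^'] -->
    - \int[P0]_z (f0 z * s z).
  apply: cvg_trans D; apply: near_eq_cvg; near=> t.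
  have te : `|t| < eps by near: t; exact: (near_submodel reg).
  have t0 : t != 0 by near: t; exact: nbhs_dnbhs_neq.
  have td : 0 < `|t| < delta.
    by rewrite normr_gt0 t0/=; near: t; exact: dnbhs0_lt.
  have Et : \int[Pt t]_z f t z = 0 by near: t.
  have sf0t := sqint_bounded (Pt t) mf0 f0M.
  (* Recovered from [f t = t * g t + f0], since the second-moment bound under [Pt t] concerns the
     quotient and not [f t] itself. *)
  have sft : sqint (Pt t) (f t).
    have := sqintD (sqintZ t (sgt _ te td)) sf0t.
    by congr sqint; apply/funext => z; rewrite /g; field.
  have E (Q : probability T R) : sqint Q (f t) -> sqint Q f0 ->
      \int[Q]_z g t z = t^-1 * (\int[Q]_z f t z - \int[Q]_z f0 z).
    move=> s1 s2; rewrite -RintegralB//; [|exact: sqint_integrable..].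
    by rewrite -RintegralZl//; apply: sqint_integrable; exact: sqintB.
  rewrite /= (E P0 (sf _ te) sf0) (E (Pt t) sft sf0t) Et Ef0.
  by field.
by rewrite -(cvg_lim (@Rhausdorff R) fl) (cvg_lim (@Rhausdorff R) D).
Unshelve. all: by end_near. Qed.

(** * Approximation of scores and Hellinger distance between submodels *)

Section tangent_approximation.
Context {d : measure_display} {T : measurableType d} {R : realType}.
Variables (nu : {sigma_finite_measure set T -> \bar R})
  (model : set (probability T R)) (P0 : probability T R).
Hypotheses (dominated : forall P, model P -> P `<< nu) (P0_model : model P0).

(** A score is a one-term linear combination of scores, at distance 0 from itself. *)
Lemma score_tangent (s : T -> R) :
  scores nu model P0 s -> tangent_space nu model P0 s.
Proof.
move=> ss; have [eps [Pt reg]] := ss.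
split; first by case: reg => _ _ _ [].
move=> e e0; exists s; last first.
  rewrite /L2norm (_ : _ \o _ = cst 0%E) ?Lnorm0//.
  by apply/funext => z /=; rewrite subrr.
exists 1%N, (fun=> 1), (fun=> s); split=> //.
by apply/funext => z; rewrite big_ord1 mul1r.
Qed.

Lemma score_approximation (S : set (T -> R)) (s : T -> R) (e : R) :
  (forall s, S s -> L20 P0 s) ->
  L2closure P0 S = tangent_space nu model P0 ->
  scores nu model P0 s -> 0 < e ->
  exists2 s', S s' & nrm2 P0 (fun z => s z - s' z) < e.
Proof.
move=> SL Sd /score_tangent; rewrite -Sd => -[sL /(_ e) sS] e0.
have [s' Ss' lt] := sS e0; exists s' => //.
have ss := Lfun2_sqint sL; have ss' := Lfun2_sqint (SL _ Ss').1.
by rewrite -lte_fin -Lnorm_nrm2//; exact: sqintB.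
Qed.

Lemma hellinger_cvg0 eps Pt s : regular_submodel nu model P0 eps Pt s ->
  hellinger nu (Pt t) P0 @[t --> (0 : R)^'] --> (0 : R).
Proof.
move=> reg; have -> : (fun t => hellinger nu (Pt t) P0) = (fun t => Num.sqrt 2^-1 *
    nrm2 nu (fun z => root_density nu (Pt t) z - root_density nu P0 z)).
  by apply/funext => t; rewrite hellingerE.
rewrite -[X in _ --> X](mulr0 (Num.sqrt 2^-1)).
by apply: cvgMl_tmp; exact: (root_diff_cvg0 dominated P0_model reg).
Qed.

(** Both submodels expand around the same root density, which cancels; what remains is [t] times the
    difference of residuals plus half the score difference. The factors [Num.sqrt 2^-1] and [2^-1]
    are bounded by 1. *)
Lemma hellinger_scores eps Pt s eps' Pt' s' t :
  regular_submodel nu model P0 eps Pt s ->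
  regular_submodel nu model P0 eps' Pt' s' ->
  `|t| < eps -> `|t| < eps' -> t != 0 ->
  hellinger nu (Pt t) (Pt' t) / `|t| <=
    nrm2 nu (qmd_residual nu P0 Pt s t) +
    nrm2 nu (qmd_residual nu P0 Pt' s' t) + nrm2 P0 (fun z => s z - s' z).
Proof.
move=> reg reg' te te' t0.
have P0nu := dominated P0_model.
have sr := sqint_residual dominated P0_model reg te.
have sr' := sqint_residual dominated P0_model reg' te'.
have ss := sqintB (sqint_score reg) (sqint_score reg').
have ssq := sqint_root_density P0nu ss.
have sh := sqintZ 2^-1 ssq.
rewrite hellingerE.
have -> : (fun z => root_density nu (Pt t) z - root_density nu (Pt' t) z) =
  (fun z => t * (qmd_residual nu P0 Pt s t z - qmd_residual nu P0 Pt' s' t z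
    + 2^-1 * ((s z - s' z) * root_density nu P0 z))).
  by apply/funext => z; rewrite /qmd_residual; field.
have srr := sqintB sr sr'.
rewrite nrm2Z; last exact: sqintD.
rewrite mulrCA mulrAC divff ?normr_eq0// mul1r.
set N := nrm2 nu _.
have N0 : 0 <= N := nrm2_ge0 _ _.
apply: (@le_trans _ _ N).
  rewrite ler_piMl// -[leRHS]sqrtr1 ler_wsqrtr// invf_le1// ler1n.
  by [].
apply: (le_trans (ler_nrm2D srr sh)); apply: lerD; first exact: ler_nrm2B.
rewrite nrm2Z// (nrm2_root_density P0nu ss) ler_piMl ?nrm2_ge0//.
by rewrite ger0_norm ?invr_ge0// invf_le1// ler1n.
Qed.

End tangent_approximation.

(** * Pathwise differentiability: scores of the dense class, then all scores *)

Theorem theorem1 (d : measure_display) (T : measurableType d) (R : realType)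
  (nu : {sigma_finite_measure set T -> \bar R})
  (model : set (probability T R))
  (dominated : forall P, model P -> P `<< nu)
  (P0 : probability T R) (P0_model : model P0)
  (V : normedModType R) (H : set V)
  (beta : probability T R -> R)
  (eta : probability T R -> V) (eta_H : forall P, model P -> H (eta P))
  (m : T -> R -> V -> R)
  (m_meas : forall b e, H e -> measurable_fun [set: T] (fun z => m z b e))
  (* (1) correct specification *)
  (correct_spec : exists2 U : set (R * V), nbhs (beta P0, eta P0) U &
     forall P, model P -> U (beta P, eta P) ->
       'E_P[(fun z => m z (beta P) (eta P))]%E = 0%E)
  (* (2) coordinate smoothness along a dense class *)
  (S : set (T -> R))
  (S_scores : S `<=` scores nu model P0)
  (S_bounded : forall s, S s -> s \in Lfun P0 +oo%E /\ L20 P0 s)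
  (S_dense : L2closure P0 S = tangent_space nu model P0)
  (eps : (T -> R) -> R) (Psub : (T -> R) -> R -> probability T R)
  (Psub_regular : forall s, S s ->
     regular_submodel nu model P0 (eps s) (Psub s) s)
  (dbeta : (T -> R) -> R) (deta : (T -> R) -> V)
  (beta_smooth : forall s, S s ->
     (beta (Psub s t) - beta P0) / t @[t --> (0 : R)^'] --> dbeta s)
  (deta_adm : forall s, S s -> admissible_directions H (eta P0) (deta s))
  (eta_smooth : forall s, S s ->
     `|t^-1 *: (eta (Psub s t) - eta P0) - deta s|
       @[t --> (0 : R)^'] --> (0 : R))
  (* (3) Frechet differentiability *)
  (m_L2 : forall b e, H e -> (fun z => m z b e) \in Lfun P0 2%:E)
  (Dbeta : R -> T -> R) (Deta : V -> T -> R)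
  (m_frechet : is_frechet_L2 P0 H m (beta P0) (eta P0) Dbeta Deta)
  (* (4) regularity along submodels *)
  (f := fun (s : T -> R) (t : R) (z : T) =>
          m z (beta (Psub s t)) (eta (Psub s t)))
  (f0 := fun z : T => m z (beta P0) (eta P0))
  (f_meas : forall s, S s -> forall t : R, `|t| < eps s ->
     measurable_fun [set: T] (f s t))
  (f0_bounded : exists M : R, forall z, `|f0 z| <= M)
  (f_diff : forall s, S s -> exists2 df0 : T -> R, df0 \in Lfun P0 2%:E &
     'E_P0[(fun z => ((f s t z - f0 z) / t - df0 z) ^+ 2)%R]%E
       @[t --> (0 : R)^'] --> 0%E)
  (f_second_moment : forall s, S s -> exists delta C : R, 0 < delta /\
     forall t : R, 0 < `|t| < delta ->
       ('E_(Psub s t)[(fun z => ((f s t z - f0 z) / t) ^+ 2)%R] <= C%:E)%E)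
  (* (5) nondegenerate Jacobian *)
  (G := fine 'E_P0[Dbeta 1%R]%E)
  (G_neq0 : G != 0)
  (* (6) Neyman orthogonality *)
  (orthogonality : forall h, admissible_directions H (eta P0) h ->
     is_gateaux_derivative (fun e => fine 'E_P0[(fun z => m z (beta P0) e)]%E)
       (eta P0) h 0)
  (* (7) Hellinger Lipschitz *)
  (hellinger_lipschitz : exists c delta : R, [/\ 0 < c, 0 < delta &
     forall P1 P2, model P1 -> model P2 ->
       hellinger nu P1 P0 <= delta -> hellinger nu P2 P0 <= delta ->
       `|beta P1 - beta P2| <= c * hellinger nu P1 P2]) :
  pathwise_differentiable nu model P0 beta
    (fun z => - G^-1 * m z (beta P0) (eta P0)).
Proof.
case: f0_bounded => M f0M; case: correct_spec => U nU UE.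
have eta0_H : H (eta P0) := eta_H _ P0_model.
have mf0 : measurable_fun [set: T] f0 := m_meas _ _ eta0_H.
have sf0 : sqint P0 f0 := sqint_bounded P0 mf0 f0M.
have Ef0 : \int[P0]_z f0 z = 0.
  by rewrite -fine_expectation UE//; exact: nbhs_singleton.
have msq b e : H e -> sqint P0 (fun z => m z b e).
  by move=> He; apply: Lfun2_sqint; exact: m_L2.
have [Dbl Del _] := m_frechet.
have dM := frechet_mean m_frechet eta0_H msq.
have Llin := bounded_linear_mean_linear Del.
have [C LC] := bounded_linear_mean_bounded Del.
have GE : G = \int[P0]_z Dbeta 1 z by exact: fine_expectation.
pose phi z := - G^-1 * f0 z.
have sphi : sqint P0 phi := sqintZ _ sf0.
have Ephi : \int[P0]_z phi z = 0.
  by rewrite RintegralZl ?Ef0 ?mulr0//; exact: sqint_integrable.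
have quotient b v db dv := @frechet_difference_quotient R V H
  (fun b e => \int[P0]_z m z b e) _ _ _ _ C b v db dv Llin LC dM.
(* Along the line [eta P0 + t *: h] with the first coordinate frozen, the chain rule gives the
   derivative [E_0[Deta h]], while orthogonality gives 0; limits are unique. *)
have L_adm h : admissible_directions H (eta P0) h -> \int[P0]_z Deta h z = 0.
  move=> hadm; have [e e0 he] := hadm.
  have [ex dv] := orthogonality _ hadm.
  have q1 : (\int[P0]_z m z (beta P0) (eta P0 + t *: h) -
      \int[P0]_z m z (beta P0) (eta P0)) / t @[t --> (0 : R)^'] -->
      (\int[P0]_z Dbeta 1 z) * 0 + \int[P0]_z Deta h z.
    apply: (quotient (fun=> beta P0) (fun t => eta P0 + t *: h)).
    - by near=> t; apply: he; near: t; exact: dnbhs0_lt.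
    - by under eq_fun do rewrite subrr mul0r; exact: cvg_cst.
    - have ch : h @[_ --> (0 : R)^'] --> h by exact: cvg_cst.
      apply: cvg_trans ch; apply: near_eq_cvg; near=> t.
      have t0 : t != 0 by near: t; exact: nbhs_dnbhs_neq.
      by rewrite addrAC subrr add0r scalerA mulVf// scale1r.
  rewrite mulr0 add0r in q1.
  (* Identifies the increment quotient inside [derive] with the plain one of [q1]. *)
  have q2 : (fun k : R => k^-1 *: (((fun t : R => fine
      'E_P0[(fun z => m z (beta P0) (eta P0 + t *: h)%R)]%E) \o shift 0) (k *: 1)
      - fine 'E_P0[(fun z => m z (beta P0) (eta P0 + 0 *: h)%R)]%E)) =
    (fun t => (\int[P0]_z m z (beta P0) (eta P0 + t *: h) -
      \int[P0]_z m z (beta P0) (eta P0)) / t).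
    apply/funext => t /=; rewrite scale0r !addr0 !fine_expectation mulrC.
    by rewrite /GRing.scale/= mulr1.
  by move: dv; rewrite /derive q2 => <-; apply/esym; apply: cvg_lim.
have dbetaE s : S s -> dbeta s = \int[P0]_z (phi z * s z).
  move=> Ss; have reg := Psub_regular _ Ss.
  have [df0 df0L fdf] := f_diff _ Ss.
  have [delta [K [delta0 fK]]] := f_second_moment _ Ss.
  have eps_model t : `|t| < eps s -> model (Psub s t).
    by case: reg => _ + _ _ _; exact.
  have sf t : `|t| < eps s -> sqint P0 (f s t).
    by move=> te; apply: msq; apply: eta_H; exact: eps_model.
  have eta_cvg : t^-1 *: (eta (Psub s t) - eta P0) @[t --> (0 : R)^'] --> deta s.
    have es := eta_smooth _ Ss; apply/cvgrPdist_lt => e e0.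
    move/cvgrPdist_lt/(_ e e0) : es; apply: filterS => t.
    by rewrite sub0r normrN normr_id distrC.
  have beta_cvg := beta_smooth _ Ss.
  have qs : (\int[P0]_z f s t z - \int[P0]_z f0 z) / t @[t --> (0 : R)^'] -->
      (\int[P0]_z Dbeta 1 z) * dbeta s + \int[P0]_z Deta (deta s) z.
    apply: (quotient (fun t => beta (Psub s t)) (fun t => eta (Psub s t))) => //.
    by apply: filterS (near_submodel reg) => t te; apply: eta_H; exact: eps_model.
  (* Convergent difference quotients make the coordinates continuous at 0, so they eventually enter
     the neighborhood [U] on which the model is correctly specified. *)
  have Ef : \forall t \near (0 : R)^', \int[Psub s t]_z f s t z = 0.
    have bv : (beta (Psub s t), eta (Psub s t)) @[t --> (0 : R)^'] -->
        (beta P0, eta P0).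
      exact: cvg_pair (cvg_difference_quotientR beta_cvg)
        (cvg_difference_quotient eta_cvg).
    apply: filterS2 (near_submodel reg) (bv _ nU) => t te Ut.
    by rewrite -fine_expectation UE//; exact: eps_model.
  have := moment_equation_derivative dominated P0_model reg mf0 f0M Ef0 sf Ef
    (Lfun2_sqint df0L) fdf delta0 fK qs.
  rewrite (L_adm _ (deta_adm _ Ss)) addr0 -GE => GdE.
  (* The nuisance term being gone, [G * dbeta s] equals minus the mean of [f0 * s]; dividing by [G]
     produces [phi]. *)
  apply: (mulfI G_neq0); rewrite GdE.
  have I : P0.-integrable [set: T] (EFin \o (fun z => f0 z * s z)).
    by apply: sqintM => //; exact: sqint_score reg.
  under [in RHS]eq_Rintegral do rewrite /phi -mulrA.
  by rewrite RintegralZl// mulrA mulrN divff// mulN1r.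
split.
  split; first exact: (sqint_Lfun2 sphi).
  rewrite unlock -[LHS]fineK; first by congr EFin; exact: Ephi.
  by apply: integrable_fin_num => //; exact: sqint_integrable sphi.
move=> eps1 Pt s reg.
rewrite fine_expectation.
have [c [delta [c0 delta0 lip]]] := hellinger_lipschitz.
have Pt0 : Pt 0 = P0 by case: reg.
have key : (beta (Pt t) - beta P0) / t @[t --> (0 : R)^'] -->
    \int[P0]_z (phi z * s z).
  apply/cvgrPdist_le => e e0.
  (* Replacing [s] by [s'] costs [c] times their distance through the Lipschitz bound and
     [nrm2 P0 phi] times it through the inner product; closeness [e / 2 / K] keeps the total below
     [e / 2]. *)
  pose K := c + nrm2 P0 phi + 1.
  have K0 : 0 < K by rewrite ltr_wpDl ?addr_ge0 ?nrm2_ge0 ?ltW.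
  have eK : 0 < e / 2 / K by rewrite !divr_gt0.
  have [s' Ss' ss'] := score_approximation (fun s Ss => (S_bounded _ Ss).2) S_dense
    (ex_intro _ eps1 (ex_intro _ Pt reg)) eK.
  have reg' := Psub_regular _ Ss'.
  have h1 := hellinger_cvg0 dominated P0_model reg.
  have h2 := hellinger_cvg0 dominated P0_model reg'.
  (* The other half of [e] is split in three: one share for each residual, divided by [c] in advance
     of the Lipschitz factor, and one for the convergence along the submodel of [s']. *)
  have c6 : 0 < e / 6 by rewrite divr_gt0.
  have c6c : 0 < e / 6 / c by rewrite divr_gt0.
  have r1 := residual_cvg0 reg.
  have r2 := residual_cvg0 reg'.
  have near0 (g : R -> R) (k : R) : 0 < k -> g t @[t --> (0 : R)^'] --> (0 : R) ->
      \forall t \near (0 : R)^', g t <= k.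
    move=> k0 /cvgrPdist_le/(_ k k0); apply: filterS => t.
    by rewrite sub0r normrN; apply: le_trans; exact: ler_norm.
  have bs := beta_smooth _ Ss'; rewrite (dbetaE _ Ss') in bs.
  near=> t.
  have t0 : t != 0 by near: t; exact: nbhs_dnbhs_neq.
  have te : `|t| < eps1 by near: t; exact: (near_submodel reg).
  have te' : `|t| < eps s' by near: t; exact: (near_submodel reg').
  have m1 : model (Pt t) by have [_ + _ _ _] := reg; exact.
  have m2 : model (Psub s' t) by have [_ + _ _ _] := reg'; exact.
  have d1 : hellinger nu (Pt t) P0 <= delta by near: t; exact: near0 h1.
  have d2 : hellinger nu (Psub s' t) P0 <= delta by near: t; exact: near0 h2.
  have n1 : nrm2 nu (qmd_residual nu P0 Pt s t) <= e / 6 / c.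
    by near: t; exact: near0 r1.
  have n2 : nrm2 nu (qmd_residual nu P0 (Psub s') s' t) <= e / 6 / c.
    by near: t; exact: near0 r2.
  have bt : `|\int[P0]_z (phi z * s' z) - (beta (Psub s' t) - beta P0) / t|
      <= e / 6.
    by near: t; move/cvgrPdist_le : bs; exact.
  have Hl := lip _ _ m1 m2 d1 d2.
  have Hs := hellinger_scores dominated P0_model reg reg' te te' t0.
  have s1 := sqint_score reg; have s2 := sqint_score reg'.
  have A1 : `|(beta (Pt t) - beta (Psub s' t)) / t| <=
      e / 6 + e / 6 + c * (e / 2 / K).
    rewrite normrM normfV; apply: (@le_trans _ _
      (c * (hellinger nu (Pt t) (Psub s' t) / `|t|))).
      by rewrite mulrA ler_wpM2r ?invr_ge0.
    apply: (@le_trans _ _ (c * (e / 6 / c + e / 6 / c + e / 2 / K))).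
      rewrite (ler_wpM2l (ltW c0))//; apply: (le_trans Hs).
      by rewrite !lerD// ltW.
    by rewrite !mulrDr mulrCA divff ?mulr1 ?gt_eqF.
  have A2 : `|\int[P0]_z (phi z * s z) - \int[P0]_z (phi z * s' z)| <=
      nrm2 P0 phi * (e / 2 / K).
    rewrite -RintegralB//; [|exact: sqintM..].
    under eq_Rintegral do rewrite -mulrBr.
    apply: (le_trans (cauchy_schwarz sphi (sqintB s1 s2))).
    by rewrite ler_wpM2l ?nrm2_ge0// ltW.
  (* Three errors: change of score in the inner product ([A2]), the known derivative for [s']
     ([bt]), and the gap between the two submodels ([A1]). *)
  have -> : \int[P0]_z (phi z * s z) - (beta (Pt t) - beta P0) / t =
    (\int[P0]_z (phi z * s z) - \int[P0]_z (phi z * s' z)) +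
    (\int[P0]_z (phi z * s' z) - (beta (Psub s' t) - beta P0) / t) -
    (beta (Pt t) - beta (Psub s' t)) / t by field.
  apply: (le_trans (ler_normB _ _)).
  apply: (le_trans (lerD (le_trans (ler_normD _ _) (lerD A2 bt)) A1)).
  have KE : K * (e / 2 / K) = e / 2 by rewrite mulrC divfK ?gt_eqF.
  have eK0 := ltW eK.
  move: KE; rewrite /K !mulrDl mul1r; rewrite -/K => KE.
  by lra.
(* The quotient in [derive] is based at [Pt 0], which is [P0], so [key] gives both existence and
   value of the derivative. *)
have quo : (fun h : R => h^-1 *: (((fun t => beta (Pt t)) \o shift 0) (h *: 1)
    - beta (Pt 0))) = (fun t => (beta (Pt t) - beta P0) / t).
  apply/funext => t /=; rewrite Pt0 addr0 mulrC.
  by rewrite /GRing.scale/= mulr1.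
apply: DeriveDef.
  by rewrite /derivable quo; apply: (cvgP _ key).
by rewrite /derive quo; apply: cvg_lim => //; exact: key.
Unshelve. all: by end_near. Qed.
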